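(* Let $V$ be a finite-dimensional irreducible $K$-module. Then $V$ is an $L$-module, i.e. $x_1$ acts by $0$ on $V$ so that the action of $K$ factors through the projection $K\to L$; in particular $\dim V=1$ or $\dim V=2$.
   Context: $\Bbbk$ is an algebraically closed field of characteristic $0$. $K$ is the $\Bbbk$-algebra generated by $x_1,x_2,g^{\pm1}$ with defining relations (where $x_{21}=x_1x_2+x_2x_1$): $gg^{-1}=g^{-1}g=1$, $x_1^2=0$, $x_2x_{21}=x_{21}x_2+x_1x_{21}$, $gx_1g^{-1}=-x_1$, $gx_2g^{-1}=x_1-x_2$ (the bosonization of the super Jordan plane by the group algebra of an infinite cyclic group). $L$ is the algebra generated by $y$ and $g^{\pm1}$ with relations $gg^{-1}=g^{-1}g=1$, $gyg^{-1}=-y$; the projection $K\to L$ is $x_1\mapsto 0$, $x_2\mapsto y$, $g\mapsto g$, with kernel $Kx_1K$. Modules are left modules. *)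

(* Defs.v *)
From HB Require Import structures.
From mathcomp Require Import all_boot all_order all_algebra.
From mathcomp Require Import boolp.

Set Implicit Arguments.
Unset Strict Implicit.
Unset Printing Implicit Defensive.

Import GRing.Theory.
Local Open Scope ring_scope.
Local Open Scope quotient_scope.

(* Associative unital algebras given by generators and relations: the        *)
(* expressions over the generators, modulo the least congruence containing   *)
(* the algebra axioms and the given relations. The universal property is     *)
(* given by lift_relsP, lift_rels_monoid, lift_gen and presented_ind.        *)

Inductive aexpr (k I : Type) : Type :=
| Zero
| One
| Gen of I
| Add of aexpr k I & aexpr k I
| Mul of aexpr k I & aexpr k I
| Scale of k & aexpr k I.
Arguments Zero {k I}.
Arguments One {k I}.
Arguments Gen {k I} i.

HB.instance Definition _ k I := gen_eqMixin (aexpr k I).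
HB.instance Definition _ k I := gen_choiceMixin (aexpr k I).

Declare Scope aexpr_scope.
Delimit Scope aexpr_scope with aexpr.
Bind Scope aexpr_scope with aexpr.
Notation "0" := Zero : aexpr_scope.
Notation "1" := One : aexpr_scope.
Notation "e + f" := (Add e f) : aexpr_scope.
Notation "e * f" := (Mul e f) : aexpr_scope.
Notation "- e" := (Scale (- 1)%R e) : aexpr_scope.
Notation "e - f" := (Add e (Scale (- 1)%R f)) : aexpr_scope.
Notation "a *: e" := (Scale a e) : aexpr_scope.

Definition relations (k I : Type) := seq (aexpr k I * aexpr k I).

Section Presentation.
Variables (k : fieldType) (I : Type) (rels : relations k I).
Implicit Types (a b : k) (e f : aexpr k I).

Inductive cong : aexpr k I -> aexpr k I -> Prop :=
| cong_rel p of p \in rels : cong p.1 p.2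
| cong_refl e : cong e e
| cong_sym e f of cong e f : cong f e
| cong_trans e f h of cong e f & cong f h : cong e h
| cong_add e e' f f' of cong e e' & cong f f' : cong (e + f) (e' + f')
| cong_mul e e' f f' of cong e e' & cong f f' : cong (e * f) (e' * f')
| cong_scale a e e' of cong e e' : cong (a *: e) (a *: e')
| cong_addA e f h : cong (e + (f + h)) ((e + f) + h)
| cong_addC e f : cong (e + f) (f + e)
| cong_add0 e : cong (0 + e) e
| cong_addN e : cong (- e + e) 0
| cong_mulA e f h : cong (e * (f * h)) ((e * f) * h)
| cong_mul1l e : cong (1 * e) e
| cong_mul1r e : cong (e * 1) e
| cong_mulDl e f h : cong ((e + f) * h) (e * h + f * h)
| cong_mulDr e f h : cong (h * (e + f)) (h * e + h * f)
| cong_scaleA a b e : cong (a *: (b *: e)) ((a * b)%R *: e)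
| cong_scale1 e : cong (1%R *: e) e
| cong_scaleDr a e f : cong (a *: (e + f)) (a *: e + a *: f)
| cong_scaleDl a b e : cong ((a + b)%R *: e) (a *: e + b *: e)
| cong_scaleAl a e f : cong (a *: (e * f)) ((a *: e) * f)
| cong_scaleAr a e f : cong (a *: (e * f)) (e * (a *: f)).

Definition congb e f := `[< cong e f >].

Lemma congb_equiv : equiv_class_of congb.
Proof.
split=> [e|e f|f e h].
- exact/asboolP/cong_refl.
- by apply/asboolP/asboolP; apply: cong_sym.
- by move=> /asboolP ef /asboolP fh; apply/asboolP/(cong_trans ef fh).
Qed.

Canonical cong_equiv := EquivRelPack congb_equiv.

Definition presented := {eq_quot cong_equiv}.

HB.instance Definition _ := Choice.on presented.

Definition inp e : presented := \pi_{eq_quot cong_equiv} e.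
Definition outp (x : presented) : aexpr k I := repr x.

Lemma outpK x : inp (outp x) = x. Proof. exact: reprK. Qed.

Lemma inpP e f : inp e = inp f <-> cong e f.
Proof.
by split=> [/eqmodP/asboolP | ef] //; apply/eqmodP/asboolP.
Qed.

Lemma outp_cong e : cong (outp (inp e)) e.
Proof. by apply/inpP; rewrite outpK. Qed.

Definition padd x y := inp (outp x + outp y).
Definition pmul x y := inp (outp x * outp y).
Definition pscale a x := inp (a *: outp x).

Lemma inpD e f : inp (e + f) = padd (inp e) (inp f).
Proof. by apply/inpP/cong_add; apply/cong_sym/outp_cong. Qed.
Lemma inpM e f : inp (e * f) = pmul (inp e) (inp f).
Proof. by apply/inpP/cong_mul; apply/cong_sym/outp_cong. Qed.
Lemma inpZ a e : inp (a *: e) = pscale a (inp e).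
Proof. by apply/inpP/cong_scale/cong_sym/outp_cong. Qed.

Lemma inp_ind (P : presented -> Prop) : (forall e, P (inp e)) -> forall x, P x.
Proof. by move=> H x; rewrite -(outpK x). Qed.

Fact paddA : associative padd.
Proof.
elim/inp_ind=> e; elim/inp_ind=> f; elim/inp_ind=> h.
by rewrite -!inpD; apply/inpP/cong_addA.
Qed.
Fact paddC : commutative padd.
Proof.
by elim/inp_ind=> e; elim/inp_ind=> f; rewrite -!inpD; apply/inpP/cong_addC.
Qed.
Fact padd0 : left_id (inp 0) padd.
Proof. by elim/inp_ind=> e; rewrite -inpD; apply/inpP/cong_add0. Qed.
Fact paddN : left_inverse (inp 0) (pscale (- 1)) padd.
Proof. by elim/inp_ind=> e; rewrite -inpZ -inpD; apply/inpP/cong_addN. Qed.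

HB.instance Definition _ := GRing.isZmodule.Build presented
  paddA paddC padd0 paddN.

Fact pmulA : associative pmul.
Proof.
elim/inp_ind=> e; elim/inp_ind=> f; elim/inp_ind=> h.
by rewrite -!inpM; apply/inpP/cong_mulA.
Qed.
Fact pmul1l : left_id (inp 1) pmul.
Proof. by elim/inp_ind=> e; rewrite -inpM; apply/inpP/cong_mul1l. Qed.
Fact pmul1r : right_id (inp 1) pmul.
Proof. by elim/inp_ind=> e; rewrite -inpM; apply/inpP/cong_mul1r. Qed.
Fact pmulDl : left_distributive pmul padd.
Proof.
elim/inp_ind=> e; elim/inp_ind=> f; elim/inp_ind=> h.
by rewrite -!(inpM, inpD); apply/inpP/cong_mulDl.
Qed.
Fact pmulDr : right_distributive pmul padd.
Proof.
elim/inp_ind=> e; elim/inp_ind=> f; elim/inp_ind=> h.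
by rewrite -!(inpM, inpD); apply/inpP/cong_mulDr.
Qed.

HB.instance Definition _ := GRing.Zmodule_isPzRing.Build presented
  pmulA pmul1l pmul1r pmulDl pmulDr.

Fact pscaleA a b x : pscale a (pscale b x) = pscale (a * b) x.
Proof. by elim/inp_ind: x => e; rewrite -!inpZ; apply/inpP/cong_scaleA. Qed.
Fact pscale1 : left_id 1 pscale.
Proof. by elim/inp_ind=> e; rewrite -inpZ; apply/inpP/cong_scale1. Qed.
Fact pscaleDr : right_distributive pscale +%R.
Proof.
move=> a; elim/inp_ind=> e; elim/inp_ind=> f.
by rewrite /GRing.add /= -!(inpZ, inpD); apply/inpP/cong_scaleDr.
Qed.
Fact pscaleDl x : {morph pscale^~ x : a b / a + b}.
Proof.
elim/inp_ind: x => e a b /=.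
by rewrite [RHS]/GRing.add /= -!(inpZ, inpD); apply/inpP/cong_scaleDl.
Qed.

HB.instance Definition _ := GRing.Zmodule_isLmodule.Build k presented
  pscaleA pscale1 pscaleDr pscaleDl.

Fact pscaleAl a (x y : presented) : a *: (x * y) = (a *: x) * y.
Proof.
elim/inp_ind: x => e; elim/inp_ind: y => f.
by rewrite /GRing.scale /GRing.mul /= -!(inpZ, inpM); apply/inpP/cong_scaleAl.
Qed.
Fact pscaleAr a (x y : presented) : a *: (x * y) = x * (a *: y).
Proof.
elim/inp_ind: x => e; elim/inp_ind: y => f.
by rewrite /GRing.scale /GRing.mul /= -!(inpZ, inpM); apply/inpP/cong_scaleAr.
Qed.

Definition pgen (i : I) : presented := inp (Gen i).

Lemma presented_ind (P : presented -> Prop) :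
  P 0 -> P 1 -> (forall i, P (pgen i)) ->
  (forall x y, P x -> P y -> P (x + y)) ->
  (forall x y, P x -> P y -> P (x * y)) ->
  (forall a x, P x -> P (a *: x)) ->
  forall x, P x.
Proof.
move=> P0 P1 PG PD PM PZ; elim/inp_ind; elim=> //= [e He f Hf|e He f Hf|a e He].
- by rewrite inpD; apply: PD.
- by rewrite inpM; apply: PM.
- by rewrite inpZ; apply: PZ.
Qed.

Section Lift.
Variables (A : algType k) (v : I -> A).

Fixpoint aeval e : A :=
  match e with
  | Zero => 0
  | One => 1
  | Gen i => v i
  | Add e f => aeval e + aeval f
  | Mul e f => aeval e * aeval f
  | Scale a e => a *: aeval e
  end%R.

Definition satisfies := forall p, p \in rels -> aeval p.1 = aeval p.2.

Lemma aeval_cong e f : satisfies -> cong e f -> aeval e = aeval f.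
Proof.
move=> sat; elim=> {e f} //=.
- by move=> e f h _ -> _ ->.
- by move=> e e' f f' _ -> _ ->.
- by move=> e e' f f' _ -> _ ->.
- by move=> a e e' _ ->.
- by move=> e f h; rewrite addrA.
- by move=> e f; rewrite addrC.
- by move=> e; rewrite add0r.
- by move=> e; rewrite scaleN1r addNr.
- by move=> e f h; rewrite mulrA.
- by move=> e; rewrite mul1r.
- by move=> e; rewrite mulr1.
- by move=> e f h; rewrite mulrDl.
- by move=> e f h; rewrite mulrDr.
- by move=> a b e; rewrite scalerA.
- by move=> e; rewrite scale1r.
- by move=> a e f; rewrite scalerDr.
- by move=> a b e; rewrite scalerDl.
- by move=> a e f; rewrite scalerAl.
- by move=> a e f; rewrite scalerAr.
Qed.

Definition lift_rels (x : presented) : A := aeval (outp x).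

Hypothesis sat : satisfies.

Lemma lift_inp e : lift_rels (inp e) = aeval e.
Proof. exact/aeval_cong/outp_cong. Qed.

Lemma lift_gen i : lift_rels (pgen i) = v i.
Proof. exact: lift_inp. Qed.

Lemma lift_relsP : linear lift_rels.
Proof.
move=> a; elim/inp_ind=> e; elim/inp_ind=> f.
rewrite [X in lift_rels X](_ : _ = inp (a *: e + f)) ?inpD ?inpZ //.
by rewrite -inpZ -inpD !lift_inp.
Qed.

Lemma lift_rels_monoid : monoid_morphism lift_rels.
Proof.
split; first exact: lift_inp.
elim/inp_ind=> e; elim/inp_ind=> f.
by rewrite [X in lift_rels X](_ : _ = inp (e * f)) ?inpM // -inpM !lift_inp.
Qed.

Lemma presented_neq0 : (1 : presented) != 0.
Proof.
apply/eqP => /(congr1 lift_rels).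
by rewrite lift_rels_monoid.1 lift_inp => /eqP; rewrite oner_eq0.
Qed.

End Lift.
End Presentation.

Arguments pgen {k I} rels i.

(* K: the bosonization of the super Jordan plane by the group algebra of an   *)
(* infinite cyclic group.                                                    *)

Inductive Kgen := Kx1 | Kx2 | Kg | Kginv.

Section KAlgebra.
Variable k : fieldType.

Let x1 : aexpr k Kgen := Gen Kx1.
Let x2 : aexpr k Kgen := Gen Kx2.
Let g : aexpr k Kgen := Gen Kg.
Let ginv : aexpr k Kgen := Gen Kginv.
Let x21 : aexpr k Kgen := x1 * x2 + x2 * x1.

Definition Krels : relations k Kgen :=
  [:: (g * ginv, 1);
      (ginv * g, 1);
      (x1 * x1, 0);
      (x2 * x21, x21 * x2 + x1 * x21);
      (g * x1 * ginv, - x1);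
      (g * x2 * ginv, x1 - x2)]%aexpr.

Definition Kalg := presented Krels.

HB.instance Definition _ := GRing.PzRing.on Kalg.
HB.instance Definition _ := GRing.Lmodule.on Kalg.

Fact Kalg_neq0 : (1 : Kalg) != 0.
Proof.
apply: (@presented_neq0 _ _ _ k^o (fun i => match i with
  | Kx1 | Kx2 => 0 | Kg | Kginv => 1 end)).
move=> p; rewrite !inE => /or4P[||| /or3P[]] /eqP-> /=;
  by rewrite ?(mulr1, mulr0, mul0r, addr0, scaler0).
Qed.

HB.instance Definition _ :=
  GRing.PzSemiRing_isNonZero.Build Kalg Kalg_neq0.
HB.instance Definition _ :=
  GRing.Lmodule_isLalgebra.Build k Kalg (@pscaleAl _ _ Krels).
HB.instance Definition _ :=
  GRing.Lalgebra_isAlgebra.Build k Kalg (@pscaleAr _ _ Krels).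

Definition K_x1 : Kalg := pgen Krels Kx1.
Definition K_x2 : Kalg := pgen Krels Kx2.
Definition K_g : Kalg := pgen Krels Kg.
Definition K_ginv : Kalg := pgen Krels Kginv.
Definition K_x21 : Kalg := K_x1 * K_x2 + K_x2 * K_x1.

Lemma Krel p : p \in Krels -> inp Krels p.1 = inp Krels p.2.
Proof. by move=> Hp; apply/inpP/cong_rel. Qed.

Lemma K_gV : K_g * K_ginv = 1.
Proof.
have := @Krel (g * ginv, 1)%aexpr.
by rewrite !inE eqxx ?orbT /= !inpM => /(_ isT).
Qed.
Lemma K_Vg : K_ginv * K_g = 1.
Proof.
have := @Krel (ginv * g, 1)%aexpr.
by rewrite !inE eqxx ?orbT /= !inpM => /(_ isT).
Qed.
Lemma K_x1x1 : K_x1 * K_x1 = 0.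
Proof.
have := @Krel (x1 * x1, 0)%aexpr.
by rewrite !inE eqxx ?orbT /= !inpM => /(_ isT).
Qed.
Lemma K_x2x21 : K_x2 * K_x21 = K_x21 * K_x2 + K_x1 * K_x21.
Proof.
have := @Krel (x2 * x21, x21 * x2 + x1 * x21)%aexpr.
by rewrite !inE eqxx ?orbT /= !(inpM, inpD) => /(_ isT).
Qed.
Lemma K_gx1 : K_g * K_x1 * K_ginv = - K_x1.
Proof.
have := @Krel (g * x1 * ginv, - x1)%aexpr.
by rewrite !inE eqxx ?orbT /= !(inpM, inpZ) => /(_ isT).
Qed.
Lemma K_gx2 : K_g * K_x2 * K_ginv = K_x1 - K_x2.
Proof.
have := @Krel (g * x2 * ginv, x1 - x2)%aexpr.
by rewrite !inE eqxx ?orbT /= !(inpM, inpD, inpZ) => /(_ isT).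
Qed.

End KAlgebra.

(* L, the quotient of K by the ideal generated by x1, and the projection     *)
(* KtoL : K -> L.                                                            *)

Inductive Lgen := Ly | Lg | Lginv.

Section LAlgebra.
Variable k : fieldType.

Let y : aexpr k Lgen := Gen Ly.
Let g : aexpr k Lgen := Gen Lg.
Let ginv : aexpr k Lgen := Gen Lginv.

Definition Lrels : relations k Lgen :=
  [:: (g * ginv, 1); (ginv * g, 1); (g * y * ginv, - y)]%aexpr.

Definition Lalg := presented Lrels.

HB.instance Definition _ := GRing.PzRing.on Lalg.
HB.instance Definition _ := GRing.Lmodule.on Lalg.

Fact Lalg_neq0 : (1 : Lalg) != 0.
Proof.
apply: (@presented_neq0 _ _ _ k^o (fun i => match i with
  | Ly => 0 | Lg | Lginv => 1 end)).
move=> p; rewrite !inE => /or3P[] /eqP-> /=;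
  by rewrite ?(mulr1, mulr0, mul0r, scaler0).
Qed.

HB.instance Definition _ :=
  GRing.PzSemiRing_isNonZero.Build Lalg Lalg_neq0.
HB.instance Definition _ :=
  GRing.Lmodule_isLalgebra.Build k Lalg (@pscaleAl _ _ Lrels).
HB.instance Definition _ :=
  GRing.Lalgebra_isAlgebra.Build k Lalg (@pscaleAr _ _ Lrels).

Definition L_y : Lalg := pgen Lrels Ly.
Definition L_g : Lalg := pgen Lrels Lg.
Definition L_ginv : Lalg := pgen Lrels Lginv.

Definition KtoL_gen (i : Kgen) : Lalg :=
  match i with
  | Kx1 => 0
  | Kx2 => L_y
  | Kg => L_g
  | Kginv => L_ginv
  end.

Fact KtoL_sat : satisfies (Krels k) KtoL_gen.
Proof.
have rel p : p \in Lrels -> inp Lrels p.1 = inp Lrels p.2.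
  by move=> Hp; apply/inpP/cong_rel.
move=> p; rewrite !inE => /or4P[||| /or3P[]] /eqP-> /=.
- by have := rel (g * ginv, 1)%aexpr; rewrite !inE eqxx /= inpM => /(_ isT).
- by have := rel (ginv * g, 1)%aexpr; rewrite !inE eqxx orbT /= inpM => /(_ isT).
- by rewrite mulr0.
- by rewrite !(mulr0, mul0r, addr0).
- by rewrite mulr0 mul0r scaler0.
- have := rel (g * y * ginv, - y)%aexpr.
  by rewrite !inE eqxx ?orbT /= !inpM inpZ add0r => /(_ isT).
Qed.

Definition KtoL : Kalg k -> Lalg := lift_rels KtoL_gen.

HB.instance Definition _ :=
  GRing.isLinear.Build k (Kalg k) Lalg _ KtoL (lift_relsP KtoL_sat).
HB.instance Definition _ :=
  GRing.isMonoidMorphism.Build (Kalg k) Lalg KtoL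
    (lift_rels_monoid KtoL_sat).

Lemma KtoL_x1 : KtoL (K_x1 k) = 0. Proof. exact: (lift_gen KtoL_sat). Qed.
Lemma KtoL_x2 : KtoL (K_x2 k) = L_y. Proof. exact: (lift_gen KtoL_sat). Qed.
Lemma KtoL_g : KtoL (K_g k) = L_g. Proof. exact: (lift_gen KtoL_sat). Qed.

End LAlgebra.

Section Restriction.
Variables (R S : pzRingType) (f : {rmorphism R -> S}) (V : lmodType S).

Definition restr of {rmorphism R -> S} : Type := V.
Local Notation W := (restr f).

HB.instance Definition _ := GRing.Zmodule.on W.

Definition restr_scale (a : R) (v : W) : W := f a *: (v : V).

Fact restr_scaleA a b v :
  restr_scale a (restr_scale b v) = restr_scale (a * b) v.
Proof. by rewrite /restr_scale scalerA rmorphM. Qed.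
Fact restr_scale1 : left_id 1 restr_scale.
Proof. by move=> v; rewrite /restr_scale rmorph1 scale1r. Qed.
Fact restr_scaleDr : right_distributive restr_scale +%R.
Proof. by move=> a u v; apply: scalerDr. Qed.
Fact restr_scaleDl v : {morph restr_scale^~ v : a b / a + b}.
Proof. by move=> a b; rewrite /restr_scale rmorphD scalerDl. Qed.

HB.instance Definition _ := GRing.Zmodule_isLmodule.Build R W
  restr_scaleA restr_scale1 restr_scaleDr restr_scaleDl.

End Restriction.

(* A left module over a k-algebra A, seen as a k-vector space. *)
Definition underlying (k : fieldType) (A : algType k) (V : lmodType A) :
  lmodType k := restr V (GRing.in_alg A).

Definition has_dim (k : fieldType) (V : lmodType k) (n : nat) : Prop :=
  exists f : {linear V -> 'rV[k]_n}, bijective f.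

Definition finite_dimensional (k : fieldType) (V : lmodType k) : Prop :=
  exists n, has_dim V n.

Definition irreducible_module (R : pzRingType) (V : lmodType R) : Prop :=
  (exists v : V, v != 0) /\
  forall U : {pred V}, GRing.submod_closed U -> U =i pred1 0 \/ U =i predT.

(* The axioms of GRing.Zmodule_isLmodule, for a candidate action on V. *)
Definition is_action (R : pzRingType) (V : zmodType) (act : R -> V -> V) :
  Prop :=
  [/\ forall a b v, act a (act b v) = act (a * b) v,
      left_id 1 act,
      right_distributive act +%R
    & forall v, {morph act^~ v : a b / a + b}].

Definition factors_through (R S : pzRingType) (p : R -> S) (V : lmodType R) :
  Prop :=
  exists2 act : S -> V -> V, is_action act & forall a v, a *: v = act (p a) v.

(* Main.v *)
(* On V, the element z = x21 commutes with x1 and g, and [x2, z] = x1 z, so   *)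
(* ker z is a submodule. If z were invertible, then a = x2^2, which satisfies *)
(* [a, z] = z^2, would give z^-1 a - a z^-1 = 1, and taking traces           *)
(* would yield dim V = 0 in characteristic 0. Hence z = 0; then x1            *)
(* anticommutes with x2 and g, so ker x1 is a submodule, nonzero as x1^2 = 0, *)
(* and x1 = 0. Now x2^2 commutes with the action, so it is a scalar, and an   *)
(* eigenvector v of g generates the submodule spanned by v and x2 v.          *)
Require Import Defs.
From HB Require Import structures.
From mathcomp Require Import all_boot all_order all_algebra.

Import GRing.Theory.
Local Open Scope ring_scope.

(** Coordinates on [V] turn the action into matrices ([module_matrices]), and irreducibility into
    the absence of proper nonzero common stable row spaces ([K_module_irr]). The engine is then a
    Schur dichotomy, [mx_irr_kermx]: a matrix with stable kernel is invertible or zero. Applied to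
    x21, where the trace argument excludes invertibility, and then to x1, it gives [mx_K_irr_x1];
    applied to x2^2 minus one of its eigenvalues, it gives the dimension bound [mx_K_irr_dim]. Once
    x1 acts by 0, the universal property of L provides the factorization
    ([factors_through_matrices]). *)

(** * Irreducible matrix solutions of the relations of K *)

Lemma unit_commutator_sqr_dim0 (k : fieldType) (k_char0 : [pchar k] =i pred0)
    (n : nat) (A Z : 'M[k]_n) :
  Z *m A = A *m Z + Z *m Z -> Z \in unitmx -> n = 0%N.
Proof.
move=> ZA uZ; apply/eqP; rewrite -(proj1 (pcharf0P k) k_char0) -(mxtrace1 k n).
(* Multiply the relation by the inverse of [Z] on both sides; the trace then gives n = 0 in [k]. *)
have AV : A *m invmx Z = invmx Z *m A + 1%:M.
  rewrite -[A in LHS](mulKmx uZ) ZA mulmxDr mulmxDl !mulmxA mulVmx // mul1mx.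
  by rewrite mulmxK // mulmxV.
apply/eqP/(addrI (\tr (invmx Z *m A))).
by rewrite -raddfD -AV mxtrace_mulC addr0.
Qed.

Lemma eigenvector_exists (k : closedFieldType) (n : nat) (A : 'M[k]_n) :
  (n > 0)%N -> exists a, exists2 v : 'rV_n, v *m A = a *: v & v != 0.
Proof.
move=> n_gt0; have /closed_rootP[a] : size (char_poly A) != 1%N.
  by rewrite size_char_poly eqSS -lt0n.
by rewrite -eigenvalue_root_char => /eigenvalueP; exists a.
Qed.

(* Matrices act on row vectors, which reverses the products in the relations. *)
Definition mx_K_rels (k : fieldType) (n : nat) (X1 X2 G Gi : 'M[k]_n) : Prop :=
  let Z := X2 *m X1 + X1 *m X2 in
  [/\ Gi *m G = 1%:M /\ G *m Gi = 1%:M,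
      X1 *m X1 = 0,
      Z *m X2 = X2 *m Z + Z *m X1,
      Gi *m X1 *m G = - X1
    & Gi *m X2 *m G = X1 - X2].

(** Subspaces are encoded as row spaces of square matrices. Stability under [G] gives stability
    under its inverse, by [stablemx_inv]. *)
Definition mx_irr (k : fieldType) (n : nat) (X1 X2 G : 'M[k]_n) : Prop :=
  forall U : 'M_n, stablemx U X1 -> stablemx U X2 -> stablemx U G ->
  U = 0 \/ row_full U.

(** The kernel is a submodule, hence zero or everything. Asking for a stable kernel rather than for
    commutation covers x21, which need not commute with x2, and x1, which will only anticommute. *)
Lemma mx_irr_kermx (k : fieldType) (n : nat) (X1 X2 G A : 'M[k]_n) :
    mx_irr k n X1 X2 G ->
    stablemx (kermx A) X1 -> stablemx (kermx A) X2 -> stablemx (kermx A) G ->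
  A \in unitmx \/ A = 0.
Proof.
move=> irr s1 s2 sG; have [/eqP K0 | Kfull] := irr _ s1 s2 sG.
  by left; rewrite -row_free_unit -kermx_eq0.
right; apply/eqP; rewrite -[A]mul1mx -sub_kermx; exact: submx_full.
Qed.

Lemma mx_K_irr_x1 (k : fieldType) (k_char0 : [pchar k] =i pred0) (n : nat)
    (X1 X2 G Gi : 'M[k]_n) :
  (n > 0)%N -> mx_K_rels k n X1 X2 G Gi -> mx_irr k n X1 X2 G -> X1 = 0.
Proof.
move=> n_gt0 [] [GiG GGi] X11; set Z := X2 *m X1 + _ => ZX2 GX1 GX2 irr.
have X1G : X1 *m G = - (G *m X1).
  by rewrite -mulmxN -GX1 !mulmxA GGi mul1mx.
have X2G : X2 *m G = G *m X1 - G *m X2.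
  by rewrite -mulmxBr -GX2 !mulmxA GGi mul1mx.
have ZX1 : Z *m X1 = X1 *m Z.
  rewrite mulmxDl mulmxDr !mulmxA X11 mul0mx addr0 -[X2 *m X1 *m X1]mulmxA X11.
  by rewrite mulmx0 add0r.
have ZG : Z *m G = G *m Z.
  rewrite mulmxDl mulmxDr -!mulmxA X1G X2G mulmxN mulmxBr !mulmxA X1G X2G.
  by rewrite mulmxBl !mulNmx -!mulmxA X11 mulmx0 sub0r !opprK oppr0 add0r.
have ker2 : stablemx (kermx Z) X2.
  rewrite sub_kermx -mulmxA.
  (* With [Z] moved to the left, a row killed by [Z] is still killed after applying [X2]. *)
  have -> : X2 *m Z = Z *m (X2 - X1) by rewrite mulmxBr ZX2 addrK.
  by rewrite mulmxA mulmx_ker mul0mx.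
have ker1 (A : 'M_n) : comm_mx Z A -> stablemx (kermx Z) A.
  exact: comm_mx_stable_ker.
have [uZ | Z0] := mx_irr_kermx _ _ _ _ _ _ irr (ker1 _ ZX1) ker2 (ker1 _ ZG).
  (* The two correction terms are [Z X1 X2] and [X2 Z X1 = Z X2 X1], with sum [Z Z]. *)
  have ZX22 : Z *m (X2 *m X2) = X2 *m X2 *m Z + Z *m Z.
    rewrite mulmxA ZX2 mulmxDl -!mulmxA ZX2 !mulmxDr !mulmxA -addrA.
    congr (_ + _).
    have -> : X2 *m Z = Z *m (X2 - X1) by rewrite mulmxBr ZX2 addrK.
    by rewrite -[_ *m X1]mulmxA mulmxBl X11 subr0 !mulmxA.
  by rewrite (unit_commutator_sqr_dim0 _ k_char0 _ _ _ ZX22 uZ) in n_gt0.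
have X21 : X2 *m X1 = - (X1 *m X2) by apply/eqP; rewrite -addr_eq0 -/Z Z0.
have [u1 | //] : X1 \in unitmx \/ X1 = 0.
  apply: (mx_irr_kermx _ _ _ _ _ _ irr); first exact: comm_mx_stable_ker.
    by rewrite sub_kermx -mulmxA X21 mulmxN mulmxA mulmx_ker mul0mx oppr0.
  (* Passing to [- G], which has the same stable spaces, absorbs the sign of the anticommutation. *)
  have -> : stablemx (kermx X1) G = stablemx (kermx X1) (- G) by rewrite stablemxN.
  by rewrite sub_kermx mulmxN mulNmx -mulmxA -mulmxN -X1G mulmxA mulmx_ker mul0mx.
by rewrite -[X1](mulKmx u1) X11 mulmx0.
Qed.

Lemma mx_K_irr_dim (k : closedFieldType) (n : nat) (X2 G Gi : 'M[k]_n) :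
    (n > 0)%N -> mx_K_rels k n 0 X2 G Gi -> mx_irr k n 0 X2 G ->
  n = 1%N \/ n = 2%N.
Proof.
move=> n_gt0 [] [GiG GGi] _ _ _; rewrite add0r => GX2 irr.
have X2G : X2 *m G = - (G *m X2).
  by rewrite -mulmxN -GX2 !mulmxA GGi mul1mx.
have [mu [w w_mu w_neq0]] := eigenvector_exists k n (X2 *m X2) n_gt0.
have X22 : X2 *m X2 = mu%:M.
  have stab (A : 'M_n) : comm_mx (X2 *m X2) A ->
      stablemx (kermx (X2 *m X2 - mu%:M)) A.
    move=> cA; apply: comm_mx_stable_ker; apply: comm_mx_sym.
    by apply: comm_mxB; [apply: comm_mx_sym | apply: comm_mx_scalar].
  (* The kernel of [X2 X2 - mu] is stable and contains [w], so it is the whole space. *)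
  have [| | | u | /eqP] := mx_irr_kermx _ _ _ _ _ (X2 *m X2 - mu%:M) irr.
  - by rewrite stablemx0.
  - by apply: stab; rewrite /comm_mx mulmxA.
  - apply: stab; rewrite /comm_mx -mulmxA X2G mulmxN [X2 *m (G *m _)]mulmxA X2G.
    by rewrite mulNmx opprK mulmxA.
  - have w0 : w *m (X2 *m X2 - mu%:M) = 0.
      by rewrite mulmxBr w_mu mul_mx_scalar subrr.
    by rewrite -[w](mulmxK u) w0 mul0mx eqxx in w_neq0.
  by rewrite subr_eq0 => /eqP.
have [la [v v_la v_neq0]] := eigenvector_exists k n G n_gt0.
(* The span of [v] and [v X2] is stable: [v X2 X2 = mu v] and [v X2 G = - la v X2]. *)
have [||| W0 | Wfull] := irr (v + v *m X2)%MS.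
- by rewrite stablemx0.
- rewrite addsmxMr -mulmxA X22 mul_mx_scalar addsmx_sub addsmxSr.
  by rewrite (submx_trans _ (addsmxSl _ _)) // scalemx_sub.
- rewrite addsmxMr v_la -mulmxA X2G mulmxN mulmxA v_la -scalemxAl -scaleNr.
  by rewrite addsmxS // scalemx_sub.
- by have := addsmxSl v (v *m X2); rewrite W0 submx0 (negPf v_neq0).
have : (n <= 2)%N.
  rewrite -{1}(eqP Wfull) (leq_trans (mxrank_adds_leqif _ _)) //.
  by rewrite (leq_add (rank_leq_row _) (rank_leq_row _)).
by move: n_gt0; clear; case: n => [|[|[]]] //; [left | right].
Qed.

(** * From a module to matrices *)

Lemma module_matrices (k : fieldType) (A : algType k) (V : lmodType A) (n : nat)
    (f : {linear underlying V -> 'rV[k]_n}) : bijective f ->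
  exists M : A -> 'M[k]_n,
  [/\ forall a (v : V), f (a *: v) = f v *m M a,
      M 1 = 1%:M,
      forall a b, M (a * b) = M b *m M a,
      forall a b, M (a + b) = M a + M b
    & forall c a, M (c *: a) = c *: M a].
Proof.
case=> h fK hK.
have hlin : linear h.
  by move=> c u v; apply: (can_inj fK); rewrite linearP !hK.
have scaleE c (v : underlying V) : c *: v = (c%:A : A) *: (v : V) by [].
have Flin a : linear (fun u => f (a *: (h u : V))).
  move=> c u v; rewrite hlin -linearP scaleE; congr (f _).
  rewrite scalerDr scalerA scaleE; congr (_ + _).
  by rewrite scalerA mulr_algr mulr_algl.
pose F a := HB.pack_for {linear 'rV[k]_n -> 'rV[k]_n}
  (fun u => f (a *: (h u : V))) (GRing.isLinear.Build _ _ _ _ _ (Flin a)).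
pose M a := lin1_mx (F a).
have fM a (v : V) : f (a *: v) = f v *m M a by rewrite mul_rV_lin1 /= fK.
have fD (u v : V) : f (u + v : V) = f u + f v := raddfD f u v.
(* As [f] is onto, a matrix is determined by its action on the vectors [f v]. *)
have M_ext B a : (forall v, f (a *: v : V) = f v *m B) -> M a = B.
  by move=> fB; apply/eqP/mulmxP=> u; rewrite -[u]hK -fM fB.
exists M; split=> // [|a b|a b|c a]; apply: M_ext => v.
- by rewrite scale1r mulmx1.
- by rewrite -scalerA !fM mulmxA.
- by rewrite scalerDl fD !fM mulmxDr.
- by rewrite -mulr_algl -scalerA -scaleE linearZ /= fM -scalemxAr.
Qed.

(** An invertible [G] preserves rank, so the inclusion of [U G] in [U] is an equality. *)
Lemma stablemx_inv (k : fieldType) (m n : nat) (U : 'M[k]_(m, n)) (G Gi : 'M_n) :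
  G *m Gi = 1%:M -> stablemx U G -> stablemx U Gi.
Proof.
move=> GGi sG; have [uG _] := mulmx1_unit GGi.
have /submxMr -/(_ _ Gi) : (U <= U *m G)%MS.
  by rewrite -(mxrank_leqif_sup sG) mxrankMfree ?row_free_unit.
by rewrite -mulmxA GGi mulmx1.
Qed.

Section MatricesOfAModule.
Variables (k : closedFieldType) (k_char0 : [pchar k] =i pred0).
Variables (V : lmodType (Kalg k)) (n : nat).
Variables (f : {linear underlying V -> 'rV[k]_n}) (h : 'rV[k]_n -> V).
Hypotheses (fK : cancel f h) (hK : cancel h f).
Variable M : Kalg k -> 'M[k]_n.
Hypothesis fM : forall a (v : V), f (a *: v) = f v *m M a.
Hypothesis M1 : M 1 = 1%:M.
Hypothesis MM : forall a b, M (a * b) = M b *m M a.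
Hypothesis MD : forall a b, M (a + b) = M a + M b.
Hypothesis MZ : forall c a, M (c *: a) = c *: M a.
Hypothesis V_irr : irreducible_module V.

Let M0 : M 0 = 0. Proof. by rewrite -(scale0r 0) MZ scale0r. Qed.
Let MN a : M (- a) = - M a. Proof. by rewrite -scaleN1r MZ scaleN1r. Qed.

Lemma K_module_rels :
  mx_K_rels k n (M (K_x1 k)) (M (K_x2 k)) (M (K_g k)) (M (K_ginv k)).
Proof.
split; first by rewrite -!MM K_Vg K_gV M1.
- by rewrite -MM K_x1x1 M0.
- by rewrite -!(MM, MD) K_x2x21.
- by rewrite -!MM mulrA K_gx1 MN.
- by rewrite -!MM mulrA K_gx2 MD MN.
Qed.

Lemma stablemx_K_module (U : 'M[k]_n) :
    stablemx U (M (K_x1 k)) -> stablemx U (M (K_x2 k)) ->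
    stablemx U (M (K_g k)) ->
  forall a, stablemx U (M a).
Proof.
move=> s1 s2 sG; have GGi : M (K_g k) *m M (K_ginv k) = 1%:M.
  by rewrite -MM K_Vg.
apply: presented_ind => [||[]||| ] //.
- by rewrite M0 stablemx0.
- by rewrite M1 mulmx1.
- exact: stablemx_inv GGi sG.
- by move=> a b sa sb; rewrite MD stablemxD.
- by move=> a b sa sb; rewrite MM stablemxM.
- by move=> c a sa; rewrite MZ -scalemxAr scalemx_sub.
Qed.

Lemma K_module_irr :
  mx_irr k n (M (K_x1 k)) (M (K_x2 k)) (M (K_g k)).
Proof.
move=> U s1 s2 sG; have sU := stablemx_K_module U s1 s2 sG.
have fD (u v : V) : f (u + v : V) = f u + f v := raddfD f u v.
have f0 : f (0 : V) = 0 := raddf0 f.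
(* The row space of [U] pulls back along [f] to a submodule of [V]. *)
have [| U0 | UT] := V_irr.2 [pred v : V | (f v <= U)%MS].
- split=> [|a u v]; rewrite !inE ?f0 ?sub0mx // => fu fv.
  by rewrite fD fM addmx_sub // (submx_trans (submxMr _ fu)).
- left; apply/row_matrixP=> i; rewrite row0.
  have := U0 (h (row i U)); rewrite !inE hK row_sub => /esym/eqP hi0.
  by rewrite -[row i U]hK; apply: etrans (congr1 f hi0) f0.
right; rewrite -sub1mx; apply/row_subP=> i.
by have := UT (h (row i 1%:M)); rewrite !inE hK.
Qed.

Lemma K_module_dim_gt0 : (n > 0)%N.
Proof.
have [v v_neq0] := V_irr.1; rewrite lt0n; apply: contra_neq v_neq0 => n0.
rewrite -[v]fK -[RHS]fK; congr (h _).
by apply/rowP=> i; have := ltn_ord i; rewrite {2}n0.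
Qed.

Lemma K_module_x1 : M (K_x1 k) = 0.
Proof.
exact: (mx_K_irr_x1 _ k_char0 _ _ _ _ _ K_module_dim_gt0 K_module_rels
          K_module_irr).
Qed.

Lemma K_module_dim : n = 1%N \/ n = 2%N.
Proof.
have rels := K_module_rels; have irr := K_module_irr.
rewrite K_module_x1 in rels irr.
exact: (mx_K_irr_dim _ _ _ _ _ K_module_dim_gt0 rels irr).
Qed.

End MatricesOfAModule.

(** * Recovering the action of L *)

(** Transposition makes the product-reversing [M] multiplicative, so the universal property of L
    yields [psi] with [psi (KtoL a) = (M a)^T]. The size is a successor because [lift_rels] targets
    a nonzero algebra. *)
Lemma factors_through_matrices (k : fieldType) (V : lmodType (Kalg k)) (n : nat)
    (f : {linear underlying V -> 'rV[k]_n.+1}) (h : 'rV[k]_n.+1 -> V)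
    (fK : cancel f h) (hK : cancel h f) (M : Kalg k -> 'M[k]_n.+1)
    (fM : forall a (v : V), f (a *: v) = f v *m M a)
    (M1 : M 1 = 1%:M) (MM : forall a b, M (a * b) = M b *m M a)
    (MD : forall a b, M (a + b) = M a + M b)
    (MZ : forall c a, M (c *: a) = c *: M a)
    (Mx1 : M (K_x1 k) = 0) :
  factors_through (@KtoL k) V.
Proof.
have trM a b : (M (a * b))^T = (M a)^T * (M b)^T by rewrite MM trmx_mul.
have M0 : M 0 = 0 by rewrite -(scale0r 0) MZ scale0r.
have MN a : M (- a) = - M a by rewrite -scaleN1r MZ scaleN1r.
pose w i := (M match i with
  | Ly => K_x2 k | Lg => K_g k | Lginv => K_ginv k end)^T.
have sat : satisfies (Lrels k) w.
  move=> p; rewrite !inE => /or3P[] /eqP-> /=; rewrite /w -!trM.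
  - by rewrite K_gV M1 trmx1.
  - by rewrite K_Vg M1 trmx1.
  - by rewrite K_gx2 MD Mx1 add0r MN linearN scaleN1r.
pose psi : Lalg k -> 'M[k]_n.+1 := lift_rels w.
have psiP : linear psi := lift_relsP sat.
have [psi1 psiM] : monoid_morphism psi := lift_rels_monoid sat.
have psiD a b : psi (a + b) = psi a + psi b.
  by have := psiP 1 a b; rewrite !scale1r.
have psi0 : psi 0 = 0 by apply: (addrI (psi 0)); rewrite -psiD !addr0.
have psiZ c a : psi (c *: a) = c *: psi a.
  by have := psiP c a 0; rewrite !addr0 => ->; rewrite -/psi psi0 addr0.
(* It suffices to compare on generators; the one sent to 0 by [KtoL] is handled by [Mx1]. *)
have psiK a : psi (KtoL a) = (M a)^T.
  move: a; apply: presented_ind => [|| i | a b IHa IHb | a b IHa IHb | c a IHa].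
  - by rewrite raddf0 psi0 M0 trmx0.
  - by rewrite rmorph1 psi1 M1 trmx1.
  - rewrite [KtoL _](lift_gen (@KtoL_sat k)).
    case: i; try exact: lift_gen sat _.
    by rewrite [LHS]psi0 [M _]Mx1 trmx0.
  - by rewrite raddfD psiD IHa IHb MD raddfD.
  - by rewrite rmorphM psiM -/psi IHa IHb trM.
  - by rewrite linearZ psiZ IHa MZ linearZ.
have fD (u v : V) : f (u + v : V) = f u + f v := raddfD f u v.
exists (fun b v => h (f v *m (psi b)^T)).
  split=> [a b v | v | a u v | v a b]; apply: (can_inj fK); rewrite ?fD !hK.
  - by rewrite psiM trmx_mul mulmxA.
  - by rewrite psi1 trmx1 mulmx1.
  - by rewrite mulmxDl.
  - by rewrite (psiD a b) raddfD mulmxDr.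
by move=> a v; rewrite psiK trmxK -fM fK.
Qed.

Theorem theorem4p3 (k : closedFieldType) (k_char0 : [pchar k] =i pred0)
    (V : lmodType (Kalg k))
    (V_fin : finite_dimensional (underlying V))
    (V_irr : irreducible_module V) :
  [/\ forall v : V, K_x1 k *: v = 0,
      factors_through (@KtoL k) V
    & has_dim (underlying V) 1 \/ has_dim (underlying V) 2].
Proof.
have [n [f f_bij]] := V_fin.
have [M [fM M1 MM MD MZ]] := module_matrices _ _ _ _ _ f_bij.
have [h fK hK] := f_bij.
have n_gt0 := K_module_dim_gt0 _ _ _ _ _ fK V_irr.
have x1_0 := K_module_x1 _ k_char0 _ _ _ _ fK hK _ fM M1 MM MD MZ V_irr.
have n_dim := K_module_dim _ k_char0 _ _ _ _ fK hK _ fM M1 MM MD MZ V_irr.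
split.
- move=> v; rewrite -[LHS]fK -[RHS]fK fM x1_0 mulmx0; congr (h _).
  exact/esym/(raddf0 f).
- case: n n_gt0 {n_dim} f f_bij M fM M1 MM MD MZ h fK hK x1_0 => // n _.
  move=> f _ M fM M1 MM MD MZ h fK hK.
  exact: factors_through_matrices fK hK _ fM M1 MM MD MZ.
- by case: n_dim => <-; [left | right]; exists f.
Qed.
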